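(* Let $G$ be a gyrogroup and let $H$ be a subgyrogroup of $G$. Then the relation $\sim_H$ on $G$ defined by $$a\sim_H b\quad\text{if and only if}\quad \ominus a\oplus b\in H\ \text{ and }\ \mathrm{gyr}[\ominus a,b](H)=H$$ is an equivalence relation on $G$.
   Context: A gyrogroup is a nonempty set $G$ with a binary operation $\oplus$ such that: (G1) there is $0\in G$ with $0\oplus a=a$ for all $a$; (G2) for each $a$ there is $b$ with $b\oplus a=0$; (G3) for all $a,b\in G$ there is an automorphism $\mathrm{gyr}[a,b]$ of $(G,\oplus)$ (a bijection $G\to G$ preserving $\oplus$) with $a\oplus(b\oplus c)=(a\oplus b)\oplus\mathrm{gyr}[a,b]c$ for all $c\in G$; (G4) $\mathrm{gyr}[a,b]=\mathrm{gyr}[a\oplus b,b]$ for all $a,b\in G$. It is known that $0$ is a two-sided identity, every $a$ has a two-sided inverse $\ominus a$, and $\mathrm{gyr}[a,b]c=\ominus(a\oplus b)\oplus(a\oplus(b\oplus c))$. A nonempty subset $H$ of $G$ is a subgyrogroup if $H$ is a gyrogroup under the operation inherited from $G$ and, for all $a,b\in H$, the restriction of $\mathrm{gyr}[a,b]$ to $H$ is an automorphism of $H$. *)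

(* Defs.v *)
From HB Require Import structures.
From mathcomp Require Import all_boot.
From mathcomp Require Import boolp classical_sets functions.
From Stdlib Require Export RelationClasses.

Set Implicit Arguments.
Unset Strict Implicit.
Unset Printing Implicit Defensive.

Local Open Scope classical_set_scope.

Definition automorphism (T : Type) (op : T -> T -> T) (f : T -> T) : Prop :=
  bijective f /\ {morph f : x y / op x y}.

(* The existential data of (G1)-(G3) are carried by the functions zero, opp
   and gyr; nonemptiness of the carrier is witnessed by zero. *)
Record gyrogroup_axioms (T : Type) (op : T -> T -> T) (zero : T)
    (opp : T -> T) (gyr : T -> T -> T -> T) : Prop := GyrogroupAxioms {
  gyro_add0 : left_id zero op;
  gyro_addN : left_inverse zero opp op;
  gyro_aut : forall a b, automorphism op (gyr a b);
  gyro_assoc : forall a b c, op a (op b c) = op (op a b) (gyr a b c);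
  gyro_loop : forall a b, gyr a b =1 gyr (op a b) b }.

Definition is_gyrogroup (T : Type) (op : T -> T -> T) : Prop :=
  exists zero opp gyr, gyrogroup_axioms op zero opp gyr.

HB.mixin Record isGyrogroup (G : Type) := {
  gadd : G -> G -> G;
  gzero : G;
  gopp : G -> G;
  gyr : G -> G -> G -> G;
  gyrogroupP : gyrogroup_axioms gadd gzero gopp gyr }.

#[short(type="gyrogroupType")]
HB.structure Definition Gyrogroup := {G of isGyrogroup G}.

Declare Scope gyro_scope.
Delimit Scope gyro_scope with gyro.
Notation "a ⊕ b" := (gadd a b) (at level 50, left associativity) : gyro_scope.
Notation "⊖ a" := (gopp a) (at level 35, right associativity) : gyro_scope.
Local Open Scope gyro_scope.

(* H, used as a type, is the subtype of its elements; the second clause says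
   that the operation of G restricts to H and makes H a gyrogroup. *)
Definition subgyrogroup (G : gyrogroupType) (H : set G) : Prop :=
  [/\ H !=set0,
      exists2 op : H -> H -> H,
        (forall x y : H, val (op x y) = val x ⊕ val y) & is_gyrogroup op
    & forall a b, H a -> H b ->
        set_bij H H (gyr a b) /\ {in H &, {morph gyr a b : x y / x ⊕ y}}].

Definition gyro_sim (G : gyrogroupType) (H : set G) (a b : G) : Prop :=
  H (⊖ a ⊕ b) /\ gyr (⊖ a) b @` H = H.

(* Main.v *)
Require Import Defs.
From mathcomp Require Import all_boot.
From mathcomp Require Import classical_sets.

(** Solving [b = a ⊕ h] for [h := ⊖ a ⊕ b], one finds that [gyr (⊖ a) b] and
    [gyr a h] are mutually inverse ([gyr_oppK]).  Hence [a ~ b] means that [b]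
    is a translate [a ⊕ h] with [h] in [H] and [gyr a h] mapping [H] onto
    itself ([gyro_simP]), a form from which every negation has disappeared.

    Everything then follows from the two ways to reassociate
    [a ⊕ (b ⊕ (c ⊕ x))], which give the nested gyration identity
    [gyr a (b ⊕ c) ∘ gyr b c = gyr (a ⊕ b) (gyr a b c) ∘ gyr a b]
    ([gyr_nested]).
    - For symmetry, [a ⊕ h] is moved back to [a] by [k := gyr a h (⊖ h)], which
      lies in [H], and the identity with [c := ⊖ b] says that [gyr (a ⊕ h) k]
      is inverse to [gyr a h].
    - For transitivity, a second step [k] in [H] is [gyr a h k'] for some [k']
      in [H], so that [(a ⊕ h) ⊕ k = a ⊕ (h ⊕ k')]; in the identity every
      gyration except [gyr a (h ⊕ k')] is then known to preserve [H], so that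
      one preserves it too. *)

Set Implicit Arguments.
Unset Strict Implicit.
Unset Printing Implicit Defensive.

Local Open Scope classical_set_scope.
Local Open Scope gyro_scope.

(** * Gyrations *)

Section Gyrogroup.
Variable G : gyrogroupType.
Implicit Types a b c x : G.

Lemma add0g a : gzero ⊕ a = a.
Proof. exact: gyro_add0 gyrogroupP a. Qed.

Lemma addNg a : ⊖ a ⊕ a = gzero.
Proof. exact: gyro_addN gyrogroupP a. Qed.

Lemma gaddA a b c : a ⊕ (b ⊕ c) = (a ⊕ b) ⊕ gyr a b c.
Proof. exact: gyro_assoc gyrogroupP a b c. Qed.

Lemma gyr_loop a b c : gyr a b c = gyr (a ⊕ b) b c.
Proof. exact: gyro_loop gyrogroupP a b c. Qed.

Lemma gyrD a b x y : gyr a b (x ⊕ y) = gyr a b x ⊕ gyr a b y.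
Proof. by have [_] := gyro_aut gyrogroupP a b; apply. Qed.

Lemma gyr_inj a b : injective (gyr a b).
Proof. by have [/bij_inj] := gyro_aut gyrogroupP a b. Qed.

(** Adding [⊖ a] on the left turns both sides into images under the injective
    gyration [gyr (⊖ a) a]; that this gyration is trivial is only a
    consequence of cancellation. *)
Lemma gaddI a : injective (gadd a).
Proof.
move=> x y /(congr1 (gadd (⊖ a))).
by rewrite !gaddA addNg !add0g => /gyr_inj.
Qed.

Lemma gyr0g a x : gyr gzero a x = x.
Proof. by apply: (@gaddI a); have := gaddA gzero a x; rewrite !add0g. Qed.

Lemma gyrNg a x : gyr (⊖ a) a x = x.
Proof. by rewrite gyr_loop addNg gyr0g. Qed.

Lemma gaddKg a x : ⊖ a ⊕ (a ⊕ x) = x.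
Proof. by rewrite gaddA addNg gyrNg add0g. Qed.

Lemma addg0 a : a ⊕ gzero = a.
Proof. by apply: (@gaddI (⊖ a)); rewrite gaddKg addNg. Qed.

Lemma addgN a : a ⊕ ⊖ a = gzero.
Proof. by apply: (@gaddI (⊖ a)); rewrite gaddKg addg0. Qed.

Lemma oppgK a : ⊖ (⊖ a) = a.
Proof. by apply: (@gaddI (⊖ a)); rewrite addgN addNg. Qed.

Lemma gaddNKg a x : a ⊕ (⊖ a ⊕ x) = x.
Proof. by rewrite -{1}(oppgK a) gaddKg. Qed.

Lemma gyrg0 a x : gyr a gzero x = x.
Proof. by apply: (@gaddI a); have := gaddA a gzero x; rewrite add0g addg0. Qed.

Lemma gyrgN a x : gyr a (⊖ a) x = x.
Proof. by rewrite gyr_loop addgN gyr0g. Qed.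

(** Both sides are the vector [y] with
    [a ⊕ (b ⊕ (c ⊕ x)) = (a ⊕ (b ⊕ c)) ⊕ y]: the left one appears when the
    inner sum is reassociated first, the right one when the outer sum is. *)
Lemma gyr_nested a b c x :
  gyr a (b ⊕ c) (gyr b c x) = gyr (a ⊕ b) (gyr a b c) (gyr a b x).
Proof.
apply: (@gaddI (a ⊕ (b ⊕ c))).
by rewrite -gaddA -gaddA [in RHS](gaddA a b c) -gaddA -gyrD -gaddA.
Qed.

Lemma gyr_oppK a b : cancel (gyr a b) (gyr (⊖ a) (a ⊕ b)).
Proof. by move=> x; rewrite gyr_nested addNg gyr0g gyrNg. Qed.

(** The element [gyr a b (⊖ b)] is the one leading from [a ⊕ b] back to [a],
    since [(a ⊕ b) ⊕ gyr a b (⊖ b) = a ⊕ (b ⊕ ⊖ b)]. *)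
Lemma gyr_backK a b : cancel (gyr a b) (gyr (a ⊕ b) (gyr a b (⊖ b))).
Proof. by move=> x; rewrite -gyr_nested addgN gyrg0 gyrgN. Qed.

End Gyrogroup.

(** * Maps preserving a set *)

Lemma image_eq_comp (T : Type) (A : set T) (f g : T -> T) :
  f @` A = A -> g @` A = A -> [set f (g x) | x in A] = A.
Proof. by move=> fA gA; rewrite -[LHS](image_comp g f) gA. Qed.

Lemma image_eq_left_factor (T : Type) (A : set T) (f g : T -> T) :
  g @` A = A -> [set f (g x) | x in A] = A -> f @` A = A.
Proof. by move=> gA fgA; rewrite -[in LHS]gA image_comp. Qed.

Lemma image_eq_cancel (T : Type) (A : set T) (f g : T -> T) :
  cancel g f -> g @` A = A -> f @` A = A.
Proof.
move=> gK gA; apply: (image_eq_left_factor gA).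
by under eq_imagel do rewrite gK; rewrite image_id.
Qed.

(** * Subgyrogroups and the relation *)

Section Subgyrogroup.
Variables (G : gyrogroupType) (H : set G).
Hypothesis hH : subgyrogroup H.

Lemma subgyrogroupD x y : H x -> H y -> H (x ⊕ y).
Proof.
have [_ [op opE _] _] := hH => /mem_set Hx /mem_set Hy.
by have /= <- := opE (SigSub Hx) (SigSub Hy); apply/set_mem/valP.
Qed.

(** The neutral element [e] of [H] is idempotent in [G], hence zero by
    cancellation; so the opposite [y] computed in [H] satisfies
    [y ⊕ x = gzero] in [G], which forces [x = ⊖ y] and [y = ⊖ x]. *)
Lemma subgyrogroup0N : H gzero /\ (forall x, H x -> H (⊖ x)).
Proof.
have [_ [op opE [e [opp [g ax]]]] _] := hH.
have e0 : val e = gzero.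
  by apply: (@gaddI _ (val e)); rewrite -opE (gyro_add0 ax) addg0.
split=> [|x /mem_set Hx]; first by rewrite -e0; apply/set_mem/valP.
pose y := opp (SigSub Hx).
have yx0 : val y ⊕ x = gzero.
  by have /= <- := opE y (SigSub Hx); rewrite (gyro_addN ax).
have -> : ⊖ x = val y.
  by rewrite -(gaddKg (val y) x) yx0 addg0 oppgK.
exact/set_mem/valP.
Qed.

Lemma subgyrogroup_gyr a b : H a -> H b -> gyr a b @` H = H.
Proof.
have [_ _ gyrH] := hH => Ha Hb.
have [[gyrHH _ gyrHs] _] := gyrH _ _ Ha Hb.
by apply/seteqP; split=> // _ [x Hx <-]; apply: gyrHH.
Qed.

End Subgyrogroup.

(** The two gyrations in play are inverse to each other on both sides, by
    [gyr_oppK] for [a, h] and for [⊖ a, b], so each preserves [H] as soon as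
    the other does. *)
Lemma gyro_simP (G : gyrogroupType) (H : set G) (a b : G) :
  gyro_sim H a b <-> exists h, [/\ H h, gyr a h @` H = H & b = a ⊕ h].
Proof.
split=> [[Hh gyrH]|[h [Hh gyrH ->]]].
  exists (⊖ a ⊕ b); split; rewrite ?gaddNKg //.
  have gyrK := @gyr_oppK _ (⊖ a) b; rewrite oppgK in gyrK.
  exact: image_eq_cancel gyrK gyrH.
split; first by rewrite gaddKg.
exact: image_eq_cancel (@gyr_oppK _ a h) gyrH.
Qed.

Theorem theorem4p2 (G : gyrogroupType) (H : set G) (hH : subgyrogroup H) :
  Equivalence (gyro_sim H).
Proof.
have [H0 HN] := subgyrogroup0N hH.
split=> [a|a b|a b c].
- apply/gyro_simP; exists gzero; split; rewrite ?addg0 //.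
  by under eq_imagel do rewrite gyrg0; rewrite image_id.
- move=> /gyro_simP[h [Hh gyrH ->]]; apply/gyro_simP.
  exists (gyr a h (⊖ h)); split; last by rewrite -gaddA addgN addg0.
    by rewrite -[X in X _]gyrH; exists (⊖ h) => //; apply: HN.
  exact: image_eq_cancel (@gyr_backK _ a h) gyrH.
- move=> /gyro_simP[h [Hh gyrH ->]] /gyro_simP[k [Hk gyrH' ->]].
  have [k' Hk' k'E] : (gyr a h @` H) k by rewrite gyrH.
  rewrite -{k}k'E in Hk gyrH' *.
  apply/gyro_simP; exists (h ⊕ k'); split; last by rewrite gaddA.
    exact: subgyrogroupD.
  apply: (image_eq_left_factor (subgyrogroup_gyr hH Hh Hk')).
  under eq_imagel do rewrite gyr_nested.
  exact: image_eq_comp.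
Qed.
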